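(* Let $A,B$ be sets of nonnegative integers that are additive complements, and suppose that $$\limsup_{x\to\infty}\frac{A(x)B(x)}{x}=1+\delta,\qquad\text{where } 0\le \delta< C_0=\tfrac12\left(-3-\sqrt2+\sqrt{3+12\sqrt2}\right)=0.027315\ldots.$$ Then $$\limsup_{x\to\infty}\frac{\log\min\{A(x),B(x)\}}{\log x}\le f(\delta),\qquad\text{where } f(\delta)=\log_2\frac{(2\delta+2)^2}{3-2\delta+\sqrt{(3-2\delta)^2-(2\delta+2)^3}}.$$
   Context: Two sets $A,B$ of nonnegative integers are called additive complements if every sufficiently large integer can be written as $a+b$ with $a\in A$, $b\in B$. For a set $A$ of nonnegative integers, $A(x)$ denotes its counting function, i.e. the number of elements $a\in A$ with $a\le x$. *)

(* Defs.v *)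
From mathcomp Require Import all_boot all_order all_algebra finmap.
From mathcomp Require Import all_classical all_reals all_analysis.

Set Implicit Arguments.
Unset Strict Implicit.
Unset Printing Implicit Defensive.

Import Order.TTheory GRing.Theory Num.Theory.
Import numFieldNormedType.Exports.
Local Open Scope classical_set_scope.
Local Open Scope ring_scope.

Definition additive_complements (A B : set nat) : Prop :=
  \forall n \near \oo, exists a b : nat, [/\ A a, B b & n = (a + b)%N].

(* fset_set sends infinite sets to fset0, but the set below is always finite
   (and empty for x < 0). *)
Definition counting_fun (R : realType) (A : set nat) (x : R) : nat :=
  #|` fset_set [set a : nat | A a /\ a%:R <= x] |%fset.

Definition C0 (R : realType) : R :=
  2^-1 * (- 3 - Num.sqrt 2 + Num.sqrt (3 + 12 * Num.sqrt 2)).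

Definition log2 (R : realType) (x : R) : R := ln x / ln 2.

(* The argument of the square root is positive for 0 <= d <= C0. *)
Definition f_bound (R : realType) (d : R) : R :=
  log2 ((2 * d + 2) ^+ 2 /
        (3 - 2 * d + Num.sqrt ((3 - 2 * d) ^+ 2 - (2 * d + 2) ^+ 3))).

(* Main.v *)
Require Import Defs.
From mathcomp Require Import all_boot all_order all_algebra.
From mathcomp Require Import all_classical all_reals all_analysis.
From mathcomp Require Import finmap zify ring lra.

Set Implicit Arguments.
Unset Strict Implicit.
Unset Printing Implicit Defensive.

Import Order.TTheory GRing.Theory Num.Theory.
Import numFieldNormedType.Exports.
Local Open Scope classical_set_scope.
Local Open Scope ring_scope.

(** Put [l = 1 + d], [alpha n = A(2n) / A(n)] and [beta n = B(2n) / B(n)]. Since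
    [A(n) B(n)] lies between [n] and [l n] up to lower order terms,
    [alpha * beta <= 2 l + o(1)]. Every integer up to [2n] is a sum [a + b] in
    which [a <= n] or [b <= n], so
    [A(n) B(2n) + A(2n) B(n) - A(n) B(n) >= 2n - O(1)], that is
    [alpha + beta >= 1 + 2 / l - o(1)]. Suppose that [r + 2 l / r < 1 + 2 / l].
    Two numbers with product at most [r s], one of which lies in [[r, s]], have
    sum at most [r + s]; taking [s] slightly above [2 l / r], neither [alpha]
    nor [beta] enters [[r, s]]. They increase too slowly to jump over this
    segment, and both cannot stay above it because of the bound on their
    product. So one of the sets, say [A], satisfies [A(2n) <= r A(n)]
    eventually, whence [A(x) = O(x ^ log2 r)]. For [d < C0] every [r] slightly
    above [2 ^ f(d)] is admissible. *)

(** * Upper limits and polynomial growth *)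

Section LimitSuperior.
Variables (R : realType) (T : choiceType) (X : filteredType T).
Variable F : set_system X.
Implicit Types (f : X -> \bar R) (y : \bar R).

Lemma limf_esup_lt_near {FF : Filter F} f y :
  (limf_esup f F < y)%E -> \forall x \near F, (f x < y)%E.
Proof.
move=> /ereal_inf_lt[_ [V FV <-] ltVy]; apply: filterS FV => x Vx.
by apply: le_lt_trans ltVy; apply: ereal_sup_ubound; exists x.
Qed.

Lemma limf_esup_le_near f y :
  (\forall x \near F, (f x <= y)%E) -> (limf_esup f F <= y)%E.
Proof.
move=> lefy; apply: le_trans (_ : ereal_sup (f @` [set x | f x <= y]%E) <= y)%E.
  by apply: ereal_inf_lbound; exists [set x | f x <= y]%E.
by apply: ge_ereal_sup => _ [x lexy <-].
Qed.

End LimitSuperior.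

Section PolynomialGrowth.
Variable R : realType.

Lemma limf_esup_ln_ratio_le (g : R -> R) (C a : R) : 0 <= a ->
  (\forall x \near +oo, g x <= C * x `^ a) ->
  (limf_esup (fun x => (ln (g x) / ln x)%:E) (pinfty_nbhs R) <= a%:E)%E.
Proof.
move=> a0 leg; apply/lee_addgt0Pr => e e0; apply: limf_esup_le_near.
near=> x.
have x1 : 1 < x by near: x; exact: nbhs_pinfty_gt.
have x0 : 0 < x by exact: lt_trans x1.
have lnx0 : 0 < ln x by rewrite ln_gt0.
have legx : g x <= C * x `^ a by near: x.
have lnCx : expR (ln C / e) <= x.
  by near: x; apply: nbhs_pinfty_ge; exact: num_real.
rewrite -EFinD lee_fin ler_pdivrMr// mulrDl.
have [gx0|gx0] := leP (g x) 0; first by rewrite ln0// addr_ge0// mulr_ge0// ltW.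
have C_gt0 : 0 < C by rewrite -(pmulr_lgt0 _ (powR_gt0 a x0)) (lt_le_trans gx0).
have lnC : ln C <= e * ln x.
  by rewrite mulrC -ler_pdivrMr// -[leLHS]expRK ler_ln ?posrE ?expR_gt0.
rewrite addrC; apply: le_trans (lerD lnC (lexx _)).
by rewrite -ln_powR -lnM ?posrE ?powR_gt0// ler_ln ?posrE ?mulr_gt0 ?powR_gt0.
Unshelve. all: by end_near. Qed.

Lemma log2_ge0 (r : R) : 1 <= r -> 0 <= log2 r.
Proof. by move=> r1; rewrite divr_ge0// ln_ge0// ler1n. Qed.

Lemma powR_log2 (r : R) : 0 < r -> 2 `^ log2 r = r.
Proof.
move=> r0; rewrite /powR pnatr_eq0/= /log2 divfK ?lnK//.
by rewrite gt_eqF// ln_gt0// ltr1n.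
Qed.

Lemma continuous_log2 (r : R) : 0 < r -> {for r, continuous (@log2 R)}.
Proof. by move=> r0; apply: cvgMl; exact: continuous_ln. Qed.

Lemma doubling_le_powR (u : nat -> R) (r : R) :
  {homo u : m n / (m <= n)%N >-> m <= n} -> (forall n, 0 <= u n) -> 1 <= r ->
  (\forall n \near \oo, u n.*2 <= r * u n) ->
  exists C, forall n, (0 < n)%N -> u n <= C * n%:R `^ log2 r.
Proof.
move=> homo_u u0 r1 [N _ dbl]; have r0 : 0 < r by exact: lt_le_trans r1.
have iter_dbl k : u (2 ^ k * N.+1)%N <= r ^+ k * u N.+1.
  elim: k => [|k IHk]; first by rewrite mul1n expr0 mul1r.
  rewrite expnS -mulnA mul2n exprS -mulrA.
  apply: le_trans (ler_wpM2l (ltW r0) IHk); apply: dbl => /=.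
  by rewrite (leq_trans (leqnSn N))// leq_pmull// expn_gt0.
exists (r * u N.+1) => n n0.
have /andP[le2n lt2n] := trunc_log_bounds (isT : (1 < 2)%N) n0.
set k := trunc_log 2 n in le2n lt2n.
have rk : r ^+ k <= n%:R `^ log2 r.
  rewrite -powR_mulrn ?(ltW r0)// -[in leLHS](powR_log2 r0) powRAC powR_mulrn//.
  by rewrite ge0_ler_powR ?log2_ge0 ?nnegrE// -natrX ler_nat.
apply: le_trans (homo_u _ (2 ^ k.+1 * N.+1)%N _) _.
  by rewrite (leq_trans (ltnW lt2n))// leq_pmulr.
apply: le_trans (iter_dbl _) _.
by rewrite exprS mulrAC ler_wpM2l// mulr_ge0// ltW.
Qed.

End PolynomialGrowth.

(** * Sequences with small upward steps *)

Section SmallSteps.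
Variable R : realFieldType.

Lemma small_steps_avoid_segment (x : nat -> R) (r s : R) :
  (\forall n \near \oo, x n.+1 <= x n + (s - r)) ->
  (\forall n \near \oo, ~~ (r <= x n <= s)) ->
  (\forall n \near \oo, x n < r) \/ (\forall n \near \oo, s < x n).
Proof.
move=> step avoid.
have [N _ stepN] : \forall n \near \oo, x n < r -> x n.+1 < r.
  near=> n => xnr; rewrite ltNge; apply/negP => rx.
  have : x n.+1 <= x n + (s - r) by near: n.
  have : ~~ (r <= x n.+1 <= s) by near: n; apply: cvg_addnl 1%N _ avoid.
  by rewrite rx/= -ltNge; lra.
have [[m Nm xmr]|never] := pselect (exists2 m, (N <= m)%N & x m < r).
  left; exists m => //= n; elim: n => [|n IHn] /= mn.
    by move: mn xmr; rewrite leqn0 => /eqP->.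
  move: mn; rewrite leq_eqVlt => /predU1P[<-//|mn].
  by apply: stepN; [exact: leq_trans Nm mn|exact: IHn].
right; near=> n; have : ~~ (r <= x n <= s) by near: n.
rewrite negb_and -!ltNge => /orP[xnr|//]; exfalso.
by apply: never; exists n => //; near: n; exact: nbhs_infty_ge.
Unshelve. all: by end_near. Qed.

Lemma itv_mul_le_add_le (r s x y : R) : 0 < r ->
  r <= x <= s -> x * y <= r * s -> x + y <= r + s.
Proof.
move=> r0 /andP[rx xs] xy; have x0 : 0 < x by exact: lt_le_trans rx.
have : 0 <= (x - r) * (s - x) by rewrite mulr_ge0 ?subr_ge0.
by rewrite -(ler_pM2l x0); nra.
Qed.

Lemma small_steps_mul_add (x y : nat -> R) (r s : R) : 0 < r ->
  (\forall n \near \oo, x n.+1 <= x n + (s - r)) ->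
  (\forall n \near \oo, x n * y n <= r * s) ->
  (\forall n \near \oo, r + s < x n + y n) ->
  (\forall n \near \oo, x n < r) \/ (\forall n \near \oo, s < x n).
Proof.
move=> r0 step prod sum; apply: small_steps_avoid_segment step _.
apply: filterS2 prod sum => n xyn; rewrite ltNge; apply: contraNN => xn_rs.
exact: itv_mul_le_add_le xyn.
Qed.

Lemma small_steps_dichotomy (x y : nat -> R) (r s : R) : 0 < r < s ->
  (\forall n \near \oo, x n.+1 <= x n + (s - r)) ->
  (\forall n \near \oo, y n.+1 <= y n + (s - r)) ->
  (\forall n \near \oo, x n * y n <= r * s) ->
  (\forall n \near \oo, r + s < x n + y n) ->
  (\forall n \near \oo, x n < r) \/ (\forall n \near \oo, y n < r).
Proof.
move=> /andP[r0 rs] xstep ystep prod sum; have s0 : 0 < s by exact: lt_trans rs.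
have [xr|xs] := small_steps_mul_add r0 xstep prod sum; first by left.
have [||yr|ys] := small_steps_mul_add (y := x) r0 ystep; last 2 first.
- by right.
- have [n [[prodn xns] yns]] := filter_ex (filterI (filterI prod xs) ys).
  have : s * s < x n * y n by apply: ltr_pM => //; exact: ltW.
  by have : r * s < s * s; [rewrite ltr_pM2r|lra].
- by apply: filterS prod => n; rewrite mulrC.
- by apply: filterS sum => n; rewrite [x n + _]addrC.
Qed.

End SmallSteps.

Section NondecreasingNatSeq.
Variable u : nat -> nat.
Hypothesis homo_u : {homo u : m n / (m <= n)%N}.

Lemma bounded_nondecreasing_near_cst (M : nat) :
  (forall n, (u n <= M)%N) -> exists m, \forall n \near \oo, u n = m.
Proof.
move=> ubM; pose P k := `[< exists n, u n = k >].
have exP : exists k, P k by exists (u 0%N); apply/asboolP; exists 0%N.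
have ubP k : P k -> (k <= M)%N by move=> /asboolP[n <-].
have [m /asboolP[N uN] max_m] := ex_maxnP exP ubP.
exists m; exists N => //= n Nn; apply/eqP.
by rewrite eqn_leq max_m/= -?uN ?homo_u//; apply/asboolP; exists n.
Qed.

Lemma nondecreasing_near_cst_or_dvg :
  (exists m, \forall n \near \oo, u n = m) \/
  (forall M, \forall n \near \oo, (M <= u n)%N).
Proof.
have [[M ubM]|unbounded] := pselect (exists M, forall n, (u n <= M)%N).
  by left; exact: bounded_nondecreasing_near_cst ubM.
right=> M; have [N MuN] : exists N, (M < u N)%N.
  apply: contrapT => /forallNP le_uM; apply: unbounded; exists M => n.
  by rewrite leqNgt; apply/negP.
by exists N => //= n Nn; rewrite (leq_trans (ltnW MuN))// homo_u.
Qed.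

End NondecreasingNatSeq.

Definition doubling_ratio (R : fieldType) (u : nat -> nat) (n : nat) : R :=
  (u n.*2)%:R / (u n)%:R.

Lemma near_doubling_ratio_step (R : archiRealFieldType) (u : nat -> nat)
    (e : R) :
  {homo u : m n / (m <= n)%N} -> (forall n, (u n.+1 <= (u n).+1)%N) -> 0 < e ->
  \forall n \near \oo, doubling_ratio R u n.+1 <= doubling_ratio R u n + e.
Proof.
move=> homo_u incr_u e0.
have [[m [N _ cst_u]]|dvg_u] := nondecreasing_near_cst_or_dvg homo_u.
  exists N => // n /= Nn.
  by rewrite /doubling_ratio !cst_u /= ?lerDl ?ltW//; lia.
near=> n.
have u0 : (1 <= u n)%N by near: n; exact: dvg_u.
have u2 : 2 / e <= (u n)%:R.
  apply: le_trans (ltW (truncnS_gt (2 / e))) _; rewrite ler_nat.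
  by near: n; exact: dvg_u.
have un0 : 0 < (u n)%:R :> R by rewrite ltr0n.
have uS : (u n)%:R <= (u n.+1)%:R :> R by rewrite ler_nat homo_u.
have u2S : (u n.+1.*2)%:R <= (u n.*2)%:R + 2 :> R.
  rewrite -natrD ler_nat doubleS.
  by have := incr_u n.*2; have := incr_u n.*2.+1; lia.
apply: (@le_trans _ _ (((u n.*2)%:R + 2) / (u n)%:R)).
  rewrite ler_pM// lef_pV2// posrE//; exact: lt_le_trans uS.
by rewrite mulrDl lerD2l ler_pdivrMr// mulrC -ler_pdivrMr.
Unshelve. all: by end_near. Qed.

(** * Counting sums of additive complements *)

Definition elements_upto (A : set nat) (n : nat) : seq nat :=
  [seq k <- iota 0 n.+1 | `[< A k >]].

Definition count_upto (A : set nat) (n : nat) : nat := size (elements_upto A n).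

Lemma mem_elements_upto (A : set nat) (n k : nat) :
  (k \in elements_upto A n) = (k <= n)%N && `[< A k >].
Proof. by rewrite mem_filter mem_iota /= andbC. Qed.

Lemma counting_funE (R : realType) (A : set nat) (x : R) : 0 <= x ->
  counting_fun A x = count_upto A (Num.trunc x).
Proof.
move=> x0; rewrite /counting_fun.
suff -> : [set a | A a /\ a%:R <= x] =
    [set` [fset a in elements_upto A (Num.trunc x)]%fset].
  by rewrite set_fsetK card_fseq undup_id// filter_uniq// iota_uniq.
apply/seteqP; split=> a /=; rewrite in_fset mem_elements_upto truncn_ge_nat//.
  by move=> [Aa ->]; exact/asboolP.
by move=> /andP[-> /asboolP].
Qed.

Lemma elements_uptoD (A : set nat) (m n : nat) :
  elements_upto A (m + n) =
  elements_upto A m ++ [seq k <- iota m.+1 n | `[< A k >]].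
Proof. by rewrite /elements_upto -addSn iotaD filter_cat. Qed.

Lemma leq_count_upto (A : set nat) : {homo count_upto A : m n / (m <= n)%N}.
Proof.
by move=> m n /subnKC<-; rewrite /count_upto elements_uptoD size_cat leq_addr.
Qed.

Lemma count_uptoS_leq (A : set nat) (n : nat) :
  (count_upto A n.+1 <= (count_upto A n).+1)%N.
Proof.
rewrite -[n.+1]addn1 /count_upto elements_uptoD size_cat -[leqRHS]addn1.
rewrite leq_add2l /=.
by case: ifP.
Qed.

(* A sum [a + b <= m + n] has [a <= m], or else [a <= m + n] and [b <= n]. *)
Lemma additive_complements_cross_count (A B : set nat) :
  additive_complements A B ->
  exists N, forall m n,
    ((m + n).+1 + count_upto A m * count_upto B n <=
     N + (count_upto A m * count_upto B (m + n) +
          count_upto A (m + n) * count_upto B n))%N.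
Proof.
move=> [N _ sumAB]; exists N => m n.
set late := [seq k <- iota m.+1 n | `[< A k >]].
have -> : count_upto A (m + n) = (count_upto A m + size late)%N.
  by rewrite /count_upto elements_uptoD size_cat.
suff : ((m + n).+1 - N <= count_upto A m * count_upto B (m + n) +
                          size late * count_upto B n)%N by rewrite mulnDl; lia.
rewrite /count_upto -!(size_allpairs addn) -size_cat -[leqLHS](size_iota N).
apply: uniq_leq_size (iota_uniq _ _) _ => k; rewrite mem_iota => /andP[Nk kmn].
have [a [b [/asboolP Aa /asboolP Bb kE]]] := sumAB k Nk.
rewrite mem_cat; apply/orP; case: (leqP a m) => am; [left|right];
  apply/allpairsP; exists (a, b);
  by split=> //=; rewrite ?mem_elements_upto ?mem_filter ?mem_iota ?Aa ?Bb; lia.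
Qed.

Section ComplementRatios.
Variables (R : realType) (A B : set nat) (l : R).
Hypothesis complAB : additive_complements A B.
Hypothesis limsup_le : (limf_esup
  (fun x : R => ((counting_fun A x)%:R * (counting_fun B x)%:R / x)%:E)
  (pinfty_nbhs R) <= l%:E)%E.
Hypothesis l_gt0 : 0 < l.

Local Notation a n := ((count_upto A n)%:R : R).
Local Notation b n := ((count_upto B n)%:R : R).
Local Notation alpha := (doubling_ratio R (count_upto A)).
Local Notation beta := (doubling_ratio R (count_upto B)).

Lemma near_count_mul_ge (c : R) : c < 1 ->
  \forall n \near \oo, c * n%:R <= a n * b n.
Proof.
move=> c1; have [N countAB] := additive_complements_cross_count complAB.
near=> n; have Nn : N%:R <= (1 - c) * n%:R.
  rewrite mulrC -ler_pdivrMr ?subr_gt0//; near: n; exact: nbhs_infty_ger.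
have := countAB n 0%N; rewrite addn0 addnA leq_add2r.
by rewrite -(ler_nat R) natrD natrM -natr1; lra.
Unshelve. all: by end_near. Qed.

Lemma near_count_mul_lt (K : R) : l < K ->
  \forall n \near \oo, a n * b n < K * n%:R.
Proof.
move=> lK; have lKE : (l%:E < K%:E)%E by rewrite lte_fin.
have /limf_esup_lt_near/cvgr_idn ltK := le_lt_trans limsup_le lKE.
apply: filterS2 (nbhs_infty_gtr (0 : R)) ltK => n n0 /=.
by rewrite lte_fin !counting_funE// natrK ltr_pdivrMr.
Qed.

Lemma near_count_cross_ge (c : R) : c < 2 ->
  \forall n \near \oo, c * n%:R <= a n * b n.*2 + a n.*2 * b n - a n * b n.
Proof.
move=> c2; have [N countAB] := additive_complements_cross_count complAB.
near=> n; have Nn : N%:R <= (2 - c) * n%:R.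
  rewrite mulrC -ler_pdivrMr ?subr_gt0//; near: n; exact: nbhs_infty_ger.
have := countAB n n; rewrite addnn -(ler_nat R) 3!natrD !natrM -natr1.
by rewrite -[in n.*2%:R]mul2n natrM; lra.
Unshelve. all: by end_near. Qed.

Lemma near_count_gt0 : \forall n \near \oo, 0 < a n /\ 0 < b n.
Proof.
have half_lt1 : 2^-1 < 1 :> R by lra.
have half_le := near_count_mul_ge half_lt1.
apply: filterS2 (nbhs_infty_gtr (0 : R)) half_le => n n0 half.
apply/andP; rewrite !ltr0n -muln_gt0 -(ltr0n R) natrM.
by apply: lt_le_trans half; rewrite mulr_gt0.
Qed.

Lemma near_doubling_ratio_mul_le (p : R) : 2 * l < p ->
  \forall n \near \oo, alpha n * beta n <= p.
Proof.
move=> lp; have p0 : 0 < p by have := l_gt0; lra.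
pose K := (2 * l + p) / 4; have lK : l < K by rewrite /K; lra.
have [N _ ub] := near_count_mul_lt lK.
have lb : \forall n \near \oo, 2 * K / p * n%:R <= a n * b n.
  by apply: near_count_mul_ge; rewrite ltr_pdivrMr// /K; lra.
have ab_gt0 := near_count_gt0; near=> n.
have [an0 bn0] : 0 < a n /\ 0 < b n by near: n.
have abn0 : 0 < a n * b n by exact: mulr_gt0.
have Nn : (N <= n)%N by near: n; exact: nbhs_infty_ge.
have ab2 : a n.*2 * b n.*2 <= 2 * K * n%:R.
  have -> : 2 * K * n%:R = K * n.*2%:R by rewrite -mul2n natrM; ring.
  apply/ltW/ub => /=.
  by rewrite -addnn (leq_trans Nn)// leq_addr.
have abn : 2 * K * n%:R <= p * (a n * b n).
  have -> : 2 * K * n%:R = p * (2 * K / p * n%:R) by field; rewrite gt_eqF.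
  by rewrite ler_pM2l//; near: n.
by rewrite /doubling_ratio mulf_div ler_pdivrMr// (le_trans ab2).
Unshelve. all: by end_near. Qed.

Lemma near_doubling_ratio_add_gt (sigma : R) : 1 < sigma < 1 + 2 / l ->
  \forall n \near \oo, sigma < alpha n + beta n.
Proof.
move=> /andP[sigma1 sigmal]; have sigma0 : 0 < sigma - 1 by rewrite subr_gt0.
have ltl : l < 2 / (sigma - 1).
  by rewrite ltr_pdivlMr// mulrC -ltr_pdivlMr// ltrBlDl.
have [lK Klt] := midf_lt ltl; set K := (l + _) / 2 in lK Klt.
have ub := near_count_mul_lt lK.
have lb : \forall n \near \oo,
    (sigma - 1) * K * n%:R <= a n * b n.*2 + a n.*2 * b n - a n * b n.
  by apply: near_count_cross_ge; rewrite mulrC -ltr_pdivlMr.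
have ab_gt0 := near_count_gt0; near=> n.
have [an0 bn0] : 0 < a n /\ 0 < b n by near: n.
have abn0 : 0 < a n * b n by exact: mulr_gt0.
have abK : (sigma - 1) * (a n * b n) < (sigma - 1) * K * n%:R.
  by rewrite -mulrA ltr_pM2l//; near: n.
have cross : (sigma - 1) * K * n%:R <= a n * b n.*2 + a n.*2 * b n - a n * b n.
  by near: n.
by rewrite /doubling_ratio addf_div ?gt_eqF// ltr_pdivlMr//; lra.
Unshelve. all: by end_near. Qed.

Lemma near_doubling_le (r : R) :
  1 <= r -> r ^+ 2 < 2 * l -> r + 2 * l / r < 1 + 2 / l ->
  (\forall n \near \oo, a n.*2 <= r * a n) \/
  (\forall n \near \oo, b n.*2 <= r * b n).
Proof.
move=> r1 rsq rsum; have r0 : 0 < r by exact: lt_le_trans r1.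
have [] := @midf_lt _ (2 * l / r) (1 + 2 / l - r); first by rewrite ltrBrDl.
set s := (_ + _) / 2; rewrite ltr_pdivrMr// => srl; rewrite ltrBrDl => rs_lt.
have rs : r < s by rewrite -(ltr_pM2r r0) -expr2 (lt_trans rsq).
have steps X : \forall n \near \oo, doubling_ratio R (count_upto X) n.+1 <=
    doubling_ratio R (count_upto X) n + (s - r).
  apply: near_doubling_ratio_step; rewrite ?subr_gt0//.
    exact: leq_count_upto.
  exact: count_uptoS_leq.
have [] := @small_steps_dichotomy _ alpha beta r s _ (steps A) (steps B).
- by rewrite r0.
- by apply: near_doubling_ratio_mul_le; rewrite [ltRHS]mulrC.
- by apply: near_doubling_ratio_add_gt; rewrite rs_lt andbT; lra.
- move=> alpha_lt; left.
  apply: filterS2 alpha_lt near_count_gt0 => n alpha_lt [an0 _].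
  by rewrite -ler_pdivrMr// ltW.
- move=> beta_lt; right.
  apply: filterS2 beta_lt near_count_gt0 => n beta_lt [_ bn0].
  by rewrite -ler_pdivrMr// ltW.
Qed.

End ComplementRatios.

Lemma limf_esup_ln_counting_le (R : realType) (A : set nat) (g : R -> nat)
    (r : R) :
  1 <= r ->
  (\forall n \near \oo, (count_upto A n.*2)%:R <= r * (count_upto A n)%:R) ->
  (forall x, (g x <= counting_fun A x)%N) ->
  (limf_esup (fun x => (ln (g x)%:R / ln x)%:E) (pinfty_nbhs R) <=
   (log2 r)%:E)%E.
Proof.
move=> r1 dbl leg.
have [m n /leq_count_upto|n|C growth] :=
  doubling_le_powR (u := fun n => (count_upto A n)%:R) _ _ r1 dbl.
- by rewrite ler_nat.
- by [].
have C_ge0 : 0 <= C.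
  by have := growth 1%N isT; rewrite powR1 mulr1; exact: le_trans.
apply: (@limf_esup_ln_ratio_le _ _ C) => //; first exact: log2_ge0.
near=> x; have x1 : 1 <= x by near: x; apply: nbhs_pinfty_ge; exact: num_real.
have x0 : 0 <= x by exact: le_trans x1.
have := leg x; rewrite counting_funE// -(ler_nat R) => /le_trans; apply.
apply: le_trans (growth _ _) _; first by rewrite truncn_gt0.
by rewrite ler_wpM2l// ge0_ler_powR ?log2_ge0 ?nnegrE// truncn_le.
Unshelve. all: by end_near. Qed.

(** * The critical ratio *)

Section SmallRoot.
Variable R : rcfType.
Implicit Types a b c : R.

(* The smaller root of [a x^2 - 2 b x + c], with its numerator rationalized. *)
Definition small_root a b c := c / (b + Num.sqrt (b ^+ 2 - a * c)).

Variables a b c : R.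
Hypotheses (a_gt0 : 0 < a) (b_gt0 : 0 < b) (c_gt0 : 0 < c).
Hypothesis disc_gt0 : 0 < b ^+ 2 - a * c.
Let v := Num.sqrt (b ^+ 2 - a * c).
Let t := small_root a b c.

Let sqrt_disc_gt0 : 0 < v. Proof. by rewrite sqrtr_gt0. Qed.

Let small_rootM : t * (b + v) = c.
Proof. by rewrite divfK// gt_eqF// addr_gt0. Qed.

Let mul_small_root : a * t = b - v.
Proof.
have v2 : v ^+ 2 = b ^+ 2 - a * c by rewrite sqr_sqrtr// ltW.
apply: (@mulIf _ (b + v)); first by rewrite gt_eqF// addr_gt0.
by rewrite -mulrA small_rootM; ring: v2.
Qed.

Lemma small_root_gt0 : 0 < t.
Proof. by rewrite divr_gt0// addr_gt0. Qed.

Lemma small_root_sqr_lt : a * t ^+ 2 < c.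
Proof.
rewrite expr2 mulrA mul_small_root -small_rootM [ltRHS]mulrC.
by rewrite ltr_pM2r ?small_root_gt0//; have := sqrt_disc_gt0; lra.
Qed.

(* The roots have product [c / a], so [r] stays below the larger one. *)
Lemma quadratic_lt0 r : t < r -> a * r ^+ 2 < c ->
  a * r ^+ 2 - 2 * b * r + c < 0.
Proof.
move=> tr r_lt; have r0 : 0 < r by exact: lt_trans small_root_gt0 tr.
have -> : a * r ^+ 2 - 2 * b * r + c = (r - t) * (a * r - (b + v)).
  rewrite -small_rootM; transitivity
    (a * r ^+ 2 - ((b - v) + (b + v)) * r + t * (b + v)); first by ring.
  by rewrite -mul_small_root; ring.
rewrite pmulr_rlt0 ?subr_gt0// subr_lt0 -(ltr_pM2r small_root_gt0).
rewrite [ltRHS]mulrC small_rootM; apply: lt_trans r_lt.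
by rewrite -mulrA ltr_pM2l// expr2 ltr_pM2l.
Qed.

End SmallRoot.

Section CriticalRatio.
Variable R : realType.
Implicit Types d r : R.

Definition critical_ratio d :=
  small_root (2 * d + 2) (3 - 2 * d) ((2 * d + 2) ^+ 2).

Lemma f_boundE d : f_bound d = log2 (critical_ratio d).
Proof. by rewrite /critical_ratio /small_root -exprS. Qed.

(* [C0] is the positive root of [2 (d + 1) (d + 2) = sqrt 2 * (3 - 2 d)]. *)
Lemma lt_C0_quadratic d : 0 <= d -> d < C0 R ->
  (2 * d + 2) * (d + 2) < Num.sqrt 2 * (3 - 2 * d).
Proof.
rewrite /C0; set w : R := Num.sqrt 2.
set z : R := Num.sqrt (3 + 12 * w) => d0 dC.
have w2 : w ^+ 2 = 2 by rewrite sqr_sqrtr.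
have w0 : 0 <= w by rewrite sqrtr_ge0.
have z2 : z ^+ 2 = 3 + 12 * w by rewrite sqr_sqrtr//; lra.
have z0 : 0 <= z by rewrite sqrtr_ge0.
have : (2 * d + 3 + w) ^+ 2 < z ^+ 2 by rewrite ltr_pXn2r ?nnegrE//; lra.
by rewrite z2; nra.
Qed.

Lemma lt_C0_linear_gt0 d : 0 <= d -> d < C0 R -> 0 < 3 - 2 * d.
Proof.
move=> d0 dC; rewrite -(@pmulr_rgt0 _ (Num.sqrt 2)) ?sqrtr_gt0//.
apply: le_lt_trans (lt_C0_quadratic d0 dC).
by rewrite mulr_ge0// addr_ge0// mulr_ge0.
Qed.

Lemma lt_C0_discr_gt0 d : 0 <= d -> d < C0 R ->
  0 < (3 - 2 * d) ^+ 2 - (2 * d + 2) * (2 * d + 2) ^+ 2.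
Proof.
move=> d0 dC; have quad := lt_C0_quadratic d0 dC.
have lhs0 : 0 <= (2 * d + 2) * (d + 2).
  by rewrite mulr_ge0// addr_ge0// mulr_ge0.
have : ((2 * d + 2) * (d + 2)) ^+ 2 < (Num.sqrt 2 * (3 - 2 * d)) ^+ 2.
  by rewrite ltr_pXn2r// nnegrE// ltW// (le_lt_trans lhs0).
by rewrite !exprMn sqr_sqrtr//; nra.
Qed.

Lemma critical_ratio_ge1 d : 0 <= d -> d < C0 R -> 1 <= critical_ratio d.
Proof.
move=> d0 dC; have h0 := lt_C0_linear_gt0 d0 dC.
have v1 : Num.sqrt ((3 - 2 * d) ^+ 2 - (2 * d + 2) * (2 * d + 2) ^+ 2) <= 1.
  rewrite -[leRHS]sqrtr1 ler_sqrt//.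
  have -> : (3 - 2 * d) ^+ 2 - (2 * d + 2) * (2 * d + 2) ^+ 2
      = 1 - (36 * d + 20 * d ^+ 2 + 8 * d ^+ 3) by ring.
  by rewrite gerBl !addr_ge0// mulr_ge0// exprn_ge0.
have q0 : (3 - 2 * d) + 1 <= (2 * d + 2) ^+ 2 by nra.
rewrite /critical_ratio /small_root ler_pdivlMr ?mul1r.
  by apply: le_trans q0; rewrite lerD2l.
by rewrite ltr_pwDl// sqrtr_ge0.
Qed.

Lemma critical_ratio_sqr_lt d : 0 <= d -> d < C0 R ->
  critical_ratio d ^+ 2 < 2 * (1 + d).
Proof.
move=> d0 dC; have h0 := lt_C0_linear_gt0 d0 dC.
have disc := lt_C0_discr_gt0 d0 dC.
have q0 : 0 < 2 * d + 2 by lra.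
have := small_root_sqr_lt h0 (exprn_gt0 2 q0) disc.
by rewrite -/(critical_ratio d) [ltRHS]expr2 ltr_pM2l//; lra.
Qed.

(* The claim is [(1 + d) r^2 - (3 + d) r + 2 (1 + d)^2 < 0]; [critical_ratio] is
   defined from the stronger bound with [3 - 2 d] in place of [3 + d]. *)
Lemma critical_ratio_sum_lt d r : 0 <= d -> d < C0 R ->
  critical_ratio d < r -> r ^+ 2 < 2 * (1 + d) ->
  r + 2 * (1 + d) / r < 1 + 2 / (1 + d).
Proof.
move=> d0 dC tr r_lt; have h0 := lt_C0_linear_gt0 d0 dC.
have disc := lt_C0_discr_gt0 d0 dC.
have q0 : 0 < 2 * d + 2 by lra.
have r0 : 0 < r.
  by apply: lt_trans tr; exact: lt_le_trans (critical_ratio_ge1 d0 dC).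
have quad : (2 * d + 2) * r ^+ 2 - 2 * (3 - 2 * d) * r + (2 * d + 2) ^+ 2 < 0.
  apply: quadratic_lt0 => //; first exact: exprn_gt0.
  by rewrite [ltRHS]expr2 ltr_pM2l//; lra.
have dr0 : 0 <= d * r by rewrite mulr_ge0// ltW.
have -> : r + 2 * (1 + d) / r = (r ^+ 2 + 2 * (1 + d)) / r.
  by field; rewrite gt_eqF.
have -> : 1 + 2 / (1 + d) = (3 + d) / (1 + d) by field; lra.
by rewrite ltr_pdivrMr// mulrAC ltr_pdivlMr//; nra.
Qed.

End CriticalRatio.

Theorem theorem1 (R : realType) (A B : set nat) (delta : R)
  (hAB : additive_complements A B)
  (hlimsup : limf_esup
     (fun x : R => ((counting_fun A x)%:R * (counting_fun B x)%:R / x)%:E)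
     (pinfty_nbhs R) = (1 + delta)%:E)
  (hdelta0 : 0 <= delta)
  (hdelta : delta < C0 R) :
  (limf_esup
     (fun x : R =>
        (ln (minn (counting_fun A x) (counting_fun B x))%:R / ln x)%:E)
     (pinfty_nbhs R) <= (f_bound delta)%:E)%E.
Proof.
set t := critical_ratio delta.
have t1 : 1 <= t by exact: critical_ratio_ge1.
have log2_t : (log2 r)%:E @[r --> t^'+] --> (f_bound delta)%:E.
  rewrite f_boundE; apply: cvg_EFin; first by near=> r.
  by apply/cvg_at_right_filter/continuous_log2; exact: lt_le_trans t1.
apply: cvge_ge log2_t; near=> r.
have tr : t < r by near: r; exact: nbhs_right_gt.
have r_lt : r ^+ 2 < 2 * (1 + delta).
  near: r; apply: cvgr_lt (critical_ratio_sqr_lt hdelta0 hdelta).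
  by apply: cvg_at_right_filter; exact: exprn_continuous.
have r1 : 1 <= r by rewrite ltW// (le_lt_trans t1).
have r_gap : r + 2 * (1 + delta) / r < 1 + 2 / (1 + delta).
  exact: critical_ratio_sum_lt.
have delta1 : 0 < 1 + delta by rewrite ltr_pwDl.
have [|dblA|dblB] := near_doubling_le hAB _ delta1 r1 r_lt r_gap.
- by rewrite hlimsup.
- by apply: limf_esup_ln_counting_le r1 dblA _ => x; exact: geq_minl.
- by apply: limf_esup_ln_counting_le r1 dblB _ => x; exact: geq_minr.
Unshelve. all: by end_near. Qed.
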